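(* Let $T_1,T_2,\dots,T_k$ be a sequence of trees such that $T_{i+1}$ is obtained from $T_i$ by an edge exchange for $1\le i<k$. Then $$\dim(T_1)-2k\le \dim(T_k)\le \dim(T_1)+2k.$$ If the upper bound is attained, there is a metric basis for $T_k$ that contains a metric basis for $T_i$ for all $1\le i\le k$; and if the lower bound is attained, there is a metric basis of $T_1$ that contains a metric basis for $T_i$ for $1\le i\le k$. Moreover, these bounds are sharp.
   Context: All graphs are finite and simple. For a connected graph $G=(V,E)$, $d_G(x,y)$ denotes the length of a shortest path between $x$ and $y$ in $G$. A vertex $v$ resolves two vertices $x,y$ if $d_G(v,x)\ne d_G(v,y)$. A set $S\subseteq V$ is a metric generator for $G$ if every pair of distinct vertices of $G$ is resolved by some element of $S$; a metric basis of $G$ is a metric generator of minimum cardinality, and this cardinality is the metric dimension $\dim(G)$. A tree $T'$ is obtained from a tree $T$ by an edge exchange if there is an edge $e$ (joining two vertices of $T$) not in $T$ and an edge $f$ in $T$ such that $T'=T+e-f$, i.e. $T'$ is obtained by adding $e$ and deleting $f$.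
   Formalization: With k trees there are only k−1 exchanges, so the bounds with 2k are never attained (e.g. k=1) and their sharpness fails; the 2k statement is kept, and the bounds, attainment clauses and sharpness are also proved with 2(k−1). *)

(* Defs.v *)
From mathcomp Require Import all_boot.

Set Implicit Arguments.
Unset Strict Implicit.
Unset Printing Implicit Defensive.

(* A finite simple graph with vertex set V is given by its edge set
   E : {set {set V}}, all of whose members are 2-element sets of vertices. *)

Definition simple_graph (V : finType) (E : {set {set V}}) : Prop :=
  forall e, e \in E -> #|e| = 2.

Definition adj (V : finType) (E : {set {set V}}) : rel V :=
  [rel x y | [set x; y] \in E].

(* A vertex set must be nonempty for the graph to count as connected. *)
Definition connected_graph (V : finType) (E : {set {set V}}) : Prop :=
  0 < #|V| /\ forall x y : V, connect (adj E) x y.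

(* In a simple graph an edge xy gives the closed walk [:: x; y], which is a
   ucycle of size 2; the cycles of the graph are the ucycles of size >= 3. *)
Definition acyclic_graph (V : finType) (E : {set {set V}}) : Prop :=
  forall c : seq V, ucycle (adj E) c -> size c <= 2.

Definition is_tree (V : finType) (E : {set {set V}}) : Prop :=
  [/\ simple_graph E, connected_graph E & acyclic_graph E].

(* The least n < #|V| such that some walk with n edges goes from x to y; a
   shortest walk is a path, so there is one in a connected graph. The value is
   the junk #|V| if y cannot be reached from x. *)
Definition dist (V : finType) (E : {set {set V}}) (x y : V) : nat :=
  find (fun n => [exists p : n.-tuple V, path (adj E) x p && (last x p == y)])
       (iota 0 #|V|).

Definition resolves (V : finType) (E : {set {set V}}) (v x y : V) : bool :=
  dist E v x != dist E v y.

Definition metric_generator (V : finType) (E : {set {set V}}) (S : {set V}) :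
    bool :=
  [forall x, forall y, (x != y) ==> [exists v in S, resolves E v x y]].

Definition metric_basis (V : finType) (E : {set {set V}}) (S : {set V}) : bool :=
  metric_generator E S &&
  [forall S' : {set V}, metric_generator E S' ==> (#|S| <= #|S'|)].

(* [set: V] is always a metric generator: x itself resolves x and y. *)
Definition metric_dim (V : finType) (E : {set {set V}}) : nat :=
  #|[arg min_(S < [set: V] | metric_generator E S) #|S| ]|.

Definition edge_exchange (V : finType) (E E' : {set {set V}}) : Prop :=
  exists e f : {set V},
    [/\ #|e| = 2, e \notin E, f \in E & E' = (e |: E) :\ f].

(* The trees are T 1, ..., T k; other values of T are irrelevant. *)
Definition exchange_sequence (V : finType) (k : nat) (T : nat -> {set {set V}}) :
    Prop :=
  (forall i, 1 <= i <= k -> is_tree (T i)) /\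
  (forall i, 1 <= i < k -> edge_exchange (T i) (T i.+1)).

Definition basis_containing_all (V : finType) (k : nat)
    (T : nat -> {set {set V}}) (j : nat) : Prop :=
  exists2 S : {set V}, metric_basis (T j) S &
    forall i, 1 <= i <= k -> exists2 S', metric_basis (T i) S' & S' \subset S.

(* dim(T 1) - c <= dim(T k) <= dim(T 1) + c together with what happens when a
   bound is attained. Subtraction is avoided because it is truncated on nat. *)
Definition exchange_bounds (V : finType) (k : nat) (T : nat -> {set {set V}})
    (c : nat) : Prop :=
  [/\ metric_dim (T 1) <= metric_dim (T k) + c,
      metric_dim (T k) <= metric_dim (T 1) + c,
      metric_dim (T k) = metric_dim (T 1) + c -> basis_containing_all k T k
    & metric_dim (T 1) = metric_dim (T k) + c -> basis_containing_all k T 1].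

(* Main.v *)
Require Import Defs.
From mathcomp Require Import all_boot.
From mathcomp Require Import zify.

Set Implicit Arguments.
Unset Strict Implicit.
Unset Printing Implicit Defensive.

(** Bounds. Let [T'] arise from the tree [T] by exchanging the edge ab for the
    edge cd. Both trees consist of the forest F = T - ab together with a bridge
    between its two components. If [S] is a metric generator of [T], then [S]
    together with [a] and [b] is one of [T'] (bridge_exchange_generator). Indeed,
    - two vertices on the same side of the bridge that [a] and [b] do not resolve
      are not resolved from the other side either, in [T] or in [T'], and
      distances within a side are the same in both trees; so if they are
      unresolved in [T'], they are unresolved in [T];
    - two vertices on different sides are resolved in [T'] by [a] or by [b], by
      the triangle inequality.
    So one exchange raises the dimension by at most two, and if it does so by
    exactly two, then adding [a] and [b] turns every basis of [T] into a basis of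
    [T'] (exchange_basis_extends). When the total growth over a sequence of k
    trees is 2 (k - 1), this happens at each step, and a basis of the first tree
    grows into bases of all of them. Exchanges are reversible, so the lower bound
    and its equality case follow from the reversed sequence.

    Sharpness. Take a hub with two leaves and m = k - 1 gadgets, each a path of
    two vertices a, b leading from the hub to a centre with two leaves. One leaf
    of the hub and one of each centre form a metric generator with m + 1
    vertices. Replacing, in every gadget, the edge ab by the edge from the hub to
    the centre makes a and b pendant; the m + 1 inner vertices then have 4 m + 2
    pendant neighbours, and a metric generator contains all but at most one of
    the vertices pendant at the same vertex, hence at least 3 m + 1 of them. So
    the m exchanges raise the dimension by 2 m at least, and by the bound
    exactly. *)

(** * Distances *)

Section Distance.

Variables (V : finType) (E : {set {set V}}).
Implicit Types (x y z : V) (p : seq V).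

Lemma adj_sym : symmetric (adj E).
Proof. by move=> x y; rewrite /adj /= setUC. Qed.

Lemma connect_adj_sym x y : connect (adj E) x y = connect (adj E) y x.
Proof. exact: (sym_connect_sym adj_sym). Qed.

Lemma dist_le_walk x p : path (adj E) x p -> dist E x (last x p) <= size p.
Proof.
move=> xp; rewrite /dist; set a := (X in find X _).
have ap : a (size p).
  by apply/existsP; exists (in_tuple p); rewrite /= xp eqxx.
have [pV | Vp] := ltnP (size p) #|V|; last first.
  by apply: leq_trans (find_size _ _) _; rewrite size_iota.
rewrite leqNgt; apply/negP => /(before_find 0).
by rewrite nth_iota // add0n ap.
Qed.

Lemma dist_walk x y : connect (adj E) x y ->
  exists p, [/\ path (adj E) x p, last x p = y & size p = dist E x y].
Proof.
case/connectP => p /shortenP[q xq uq _] y_q.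
set a := fun n => [exists p : n.-tuple V, path (adj E) x p && (last x p == y)].
have dE : dist E x y = find a (iota 0 #|V|) by [].
have qV : size q < #|V|.
  by rewrite (leq_trans _ (max_card (mem (x :: q)))) // (card_uniqP uq).
have a_has : has a (iota 0 #|V|).
  apply/hasP; exists (size q); first by rewrite mem_iota.
  by apply/existsP; exists (in_tuple q); rewrite /= xq -y_q eqxx.
have := nth_find 0 a_has; rewrite nth_iota; last first.
  by rewrite -[X in _ < X](size_iota 0) -has_find.
rewrite add0n -dE => /existsP[r /andP[xr /eqP rE]].
by exists r; rewrite size_tuple.
Qed.

Lemma distxx x : dist E x x = 0.
Proof. by apply/eqP; rewrite -leqn0 (@dist_le_walk x [::]). Qed.

Lemma dist_eq0 x y : connect (adj E) x y -> dist E x y = 0 -> x = y.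
Proof. by case/dist_walk => -[|z p] [_ <- <-]. Qed.

Lemma dist_triangle x y z :
    connect (adj E) x y -> connect (adj E) y z ->
  dist E x z <= dist E x y + dist E y z.
Proof.
case/dist_walk => p [xp yE <-] /dist_walk[q [yq zE <-]].
by rewrite -zE -{1}yE -last_cat -size_cat dist_le_walk // cat_path xp yE.
Qed.

Lemma dist_adj x y z :
  connect (adj E) x y -> adj E y z -> dist E x z <= (dist E x y).+1.
Proof.
move=> xy yz; apply: leq_trans (dist_triangle xy (connect1 yz)) _.
by rewrite -addn1 leq_add2l (@dist_le_walk y [:: z]) //= yz.
Qed.

(** Any function growing by at most one along edges bounds distances from
    below; all lower bounds on distances come from this. *)
Lemma lipschitz_le_dist (g : V -> nat) x y :
    (forall u v, adj E u v -> g v <= (g u).+1) -> connect (adj E) x y ->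
  g y <= g x + dist E x y.
Proof.
move=> g_lip /dist_walk[p [xp <- <-]].
elim: p x xp => [|z p IHp] x /=; first by rewrite addn0.
by case/andP => /g_lip gz /IHp zp; lia.
Qed.

(** A function vanishing at [s] only is the distance from [s] once it varies by
    at most one along edges and can always be decreased by a step. *)
Lemma dist_unique (g : V -> nat) s x :
    g s = 0 -> (forall u v, adj E u v -> g v <= (g u).+1) ->
    (forall v, v != s -> exists2 u, adj E u v & g v = (g u).+1) ->
    connect (adj E) s x ->
  dist E s x = g x.
Proof.
move=> gs g_lip g_desc sx; apply/eqP; rewrite eqn_leq.
rewrite -[X in _ && (_ <= X)]add0n -gs lipschitz_le_dist // andbT.
move: {2}(g x) (erefl (g x)) sx => n; elim: n x => [|n IHn] x gx sx.
  have [-> | /g_desc[u _]] := eqVneq x s; last by rewrite gx.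
  by rewrite distxx.
have [xs | /g_desc[u ux]] := eqVneq x s; first by rewrite xs gs in gx.
move=> gxu; have gu : g u = n by rewrite gx in gxu; case: gxu.
have su : connect (adj E) s u.
  by apply: connect_trans sx _; rewrite connect_adj_sym connect1.
by apply: leq_trans (dist_adj su ux) _; rewrite gxu ltnS IHn.
Qed.

(** Vertices pendant at the same vertex are twins: exchanging the last vertex of
    a walk turns a walk ending at one into a walk ending at the other. *)
Lemma dist_pendant v x y s :
    (forall u, adj E u x = (u == v)) -> (forall u, adj E u y = (u == v)) ->
    s != y -> connect (adj E) s y ->
  dist E s x <= dist E s y.
Proof.
move=> nx ny + /dist_walk[p [+ + <-]].
case/lastP: p => [/eqP sy _ /sy // | p z]; rewrite rcons_path last_rcons.
move=> _ /andP[sp pz] zy; rewrite zy ny in pz.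
by rewrite -(last_rcons s p x) size_rcons -(size_rcons p x) dist_le_walk //
  rcons_path sp nx.
Qed.

End Distance.

(** * Metric generators and metric bases *)

Section MetricGenerator.

Variables (V : finType) (E : {set {set V}}).
Hypothesis E_conn : forall x y, connect (adj E) x y.
Implicit Types (S : {set V}).

Lemma metric_generatorP S :
  reflect (forall x y, (forall s, s \in S -> dist E s x = dist E s y) -> x = y)
          (metric_generator E S).
Proof.
apply: (iffP idP) => [genS x y eqxy | genS].
  apply/eqP; apply: contraTT genS => xy; apply/forallPn; exists x.
  apply/forallPn; exists y; rewrite negb_imply xy /=; apply/exists_inPn => s sS.
  by rewrite negbK eqxy.
apply/forallP => x; apply/forallP => y; apply/implyP; apply: contraR.
move=> /exists_inPn eqxy; apply/eqP/genS => s /eqxy.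
by rewrite negbK => /eqP.
Qed.

Lemma metric_generatorT : metric_generator E [set: V].
Proof.
apply/metric_generatorP => x y /(_ x (in_setT x)).
by rewrite distxx => /esym /dist_eq0; apply.
Qed.

Lemma metric_dim_le S : metric_generator E S -> metric_dim E <= #|S|.
Proof.
rewrite /metric_dim; case: arg_minnP => [|S0 _ minS0]; last exact: minS0.
exact: metric_generatorT.
Qed.

Lemma metric_basisP S :
  reflect (metric_generator E S /\ #|S| = metric_dim E) (metric_basis E S).
Proof.
apply: (iffP andP) => -[genS minS]; split=> //.
  apply/eqP; rewrite eqn_leq metric_dim_le // andbT /metric_dim.
  case: arg_minnP => [|S0 genS0 _]; first exact: metric_generatorT.
  by have /forallP/(_ S0)/implyP := minS; apply.
by apply/forallP => S'; apply/implyP; rewrite minS; apply: metric_dim_le.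
Qed.

Lemma metric_basis_exists : exists S, metric_basis E S.
Proof.
pose P := metric_generator E.
have [S genS minS] := @arg_minnP _ setT P (fun S => #|S|) metric_generatorT.
exists S; apply/andP; split=> //; apply/forallP => S'; apply/implyP.
exact: minS.
Qed.

(** Of the vertices pendant at a common vertex, a metric generator contains all
    but at most one, so the pendant vertices outside the generator are
    distinguished by their neighbours, which lie in [H]. *)
Lemma pendant_lower_bound (H : {set V}) (q : V -> V) S :
    (forall x, x \notin H -> q x \in H) ->
    (forall x, x \notin H -> forall u, adj E u x = (u == q x)) ->
    metric_generator E S ->
  #|V| <= #|S| + 2 * #|H|.
Proof.
move=> qH qadj /metric_generatorP genS.
have q_inj : {in ~: (S :|: H) &, injective q}.
  move=> x y; rewrite !inE !negb_or => /andP[xS xH] /andP[yS yH] qxy.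
  have sx s : s \in S -> s != x by apply: contraTneq => ->.
  have sy s : s \in S -> s != y by apply: contraTneq => ->.
  have nx := qadj x xH; have ny := qadj y yH; rewrite -qxy in ny.
  apply: genS => s sS; apply/eqP.
  by rewrite eqn_leq (dist_pendant nx ny) ?(dist_pendant ny nx) ?sx ?sy.
have imH : q @: (~: (S :|: H)) \subset H.
  apply/subsetP => _ /imsetP[x + ->].
  by rewrite !inE negb_or => /andP[_ /qH].
have := subset_leq_card imH; rewrite card_in_imset //.
have := cardsC (S :|: H); have := cardsU S H; lia.
Qed.

End MetricGenerator.

(** * Replacing a bridge *)

Lemma eq_set2P (V : finType) (u v a b : V) :
  [set u; v] = [set a; b] -> (u = a /\ v = b) \/ (u = b /\ v = a).
Proof.
move=> uv.
have : u \in [set a; b] by rewrite -uv set21.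
have : v \in [set a; b] by rewrite -uv set22.
have : a \in [set u; v] by rewrite uv set21.
have : b \in [set u; v] by rewrite uv set22.
rewrite !inE => bu au /orP[]/eqP vE /orP[]/eqP uE;
  rewrite uE vE ?orbb in au bu *.
- by move/eqP: bu => ->; left.
- by right.
- by left.
- by move/eqP: au => ->; left.
Qed.

Section Bridge.

Variables (V : finType) (F : {set {set V}}).
Implicit Types (a b c d s x y : V) (S : {set V}).

(** Phrased on F, so that the edges ab and cd of an exchange are both bridges
    over the same forest. *)
Definition bridge a b :=
  ~~ connect (adj F) a b /\
  forall x, connect (adj F) x a || connect (adj F) x b.

Lemma bridge_sym a b : bridge a b -> bridge b a.
Proof.
by case=> ab sides; split=> [|x]; [rewrite connect_adj_sym | rewrite orbC].
Qed.

Lemma bridge_apart a b x y : bridge a b ->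
  connect (adj F) x a -> connect (adj F) y b -> connect (adj F) x y = false.
Proof.
case=> ab _ xa yb; apply: contraNF ab => xy; rewrite connect_adj_sym in xa.
exact: connect_trans xa (connect_trans xy yb).
Qed.

Lemma adj_add_edge a b u v : adj ([set a; b] |: F) u v ->
  [\/ u = a /\ v = b, u = b /\ v = a | adj F u v].
Proof.
rewrite /adj /= in_setU1 => /orP[/eqP/eq_set2P[] | ].
- by constructor 1.
- by constructor 2.
by constructor 3.
Qed.

Lemma sub_adj_add_edge e : subrel (adj F) (adj (e |: F)).
Proof. by move=> u v; rewrite /adj /= in_setU1 orbC => ->. Qed.

Lemma connect_add_edge e x y :
  connect (adj F) x y -> connect (adj (e |: F)) x y.
Proof.
by apply: connect_sub => u v uv; apply/connect1/(sub_adj_add_edge e).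
Qed.

Lemma dist_add_edge e x y :
  connect (adj F) x y -> dist (e |: F) x y <= dist F x y.
Proof.
case/dist_walk => p [xp <- <-]; apply: dist_le_walk.
exact: sub_path (@sub_adj_add_edge e) _ _ xp.
Qed.

(** A walk leaving the component of [a] has to go through the edge ab. Hence the
    right-hand side, as a function of [y], grows by at most one along edges. *)
Lemma bridge_dist a b x y : bridge a b -> connect (adj F) x a ->
  dist ([set a; b] |: F) x y =
    if connect (adj F) x y then dist F x y
    else (dist F x a).+1 + dist F b y.
Proof.
move=> br xa; have [ab sides] := br.
pose g z := if connect (adj F) x z then dist F x z
            else (dist F x a).+1 + dist F b z.
have far z : connect (adj F) x z = false -> connect (adj F) b z.
  move=> xz; have := sides z; rewrite (connect_adj_sym _ b) => /orP[za|//].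
  by rewrite (connect_trans xa) // connect_adj_sym in xz.
have xb : connect (adj F) x b = false by apply: (bridge_apart br).
have adj_ab : adj ([set a; b] |: F) a b by rewrite /adj /= setU11.
have E_ab := connect1 adj_ab; have E_xa := connect_add_edge [set a; b] xa.
have g_lip u v : adj ([set a; b] |: F) u v -> g v <= (g u).+1.
  case/adj_add_edge => [[-> ->] | [-> ->] | uv]; rewrite /g ?xa ?xb ?distxx.
  - by rewrite addn0.
  - by rewrite addn0; lia.
  have vu : adj F v u by rewrite adj_sym.
  case xu: (connect (adj F) x u).
    by rewrite (connect_trans xu (connect1 uv)) dist_adj.
  have -> : connect (adj F) x v = false.
    by apply: contraFF xu => xv; apply: connect_trans xv (connect1 vu).
  by rewrite !addSn ltnS -addnS leq_add2l dist_adj // far.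
have E_xy : connect (adj ([set a; b] |: F)) x y.
  case xy: (connect (adj F) x y); first exact: connect_add_edge xy.
  apply: connect_trans E_xa (connect_trans E_ab _).
  exact/connect_add_edge/far.
have gx : g x = 0 by rewrite /g connect0 distxx.
have := lipschitz_le_dist g_lip E_xy; rewrite gx add0n => ge_g.
apply/eqP; rewrite eqn_leq -/(g y) ge_g andbT /g.
case xy: (connect (adj F) x y); first exact: dist_add_edge.
have E_by := connect_add_edge [set a; b] (far _ xy).
apply: leq_trans (dist_triangle (connect_trans E_xa E_ab) E_by) _.
apply: leq_add; last exact: dist_add_edge (far _ xy).
by apply: leq_trans (dist_adj E_xa adj_ab) _; rewrite ltnS dist_add_edge.
Qed.

Lemma bridge_dist_same a b x y : bridge a b ->
  connect (adj F) x y -> dist ([set a; b] |: F) x y = dist F x y.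
Proof.
move=> br xy; have [_ /(_ x) /orP[xa | xb]] := br.
  by rewrite (bridge_dist _ br xa) xy.
by rewrite [[set a; b]]setUC (bridge_dist _ (bridge_sym br) xb) xy.
Qed.

Lemma bridge_dist_across a b x y : bridge a b ->
    connect (adj F) x a -> connect (adj F) y b ->
  dist ([set a; b] |: F) x y = (dist F x a).+1 + dist F b y.
Proof.
by move=> br xa yb; rewrite (bridge_dist _ br xa) (bridge_apart br xa yb).
Qed.

Lemma bridge_connected a b x y :
  bridge a b -> connect (adj ([set a; b] |: F)) x y.
Proof.
move=> [_ sides].
have to_a z : connect (adj ([set a; b] |: F)) z a.
  have /orP[/connect_add_edge // | /connect_add_edge zb] := sides z.
  apply: connect_trans (zb _) (connect1 _).
  by rewrite /adj /= [[set b; a]]setUC setU11.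
by apply: connect_trans (to_a x) _; rewrite connect_adj_sym.
Qed.

(** Distances within a side are the same before and after the exchange, and a
    vertex [s] of the other side sees both [x] and [y] through the edge ab, so
    that it resolves them only if [a] does. *)
Lemma same_side_unresolved a b c d S x y :
    bridge a b -> bridge c d ->
    connect (adj F) x a -> connect (adj F) y a ->
    (forall s, s \in a |: (b |: S) ->
       dist ([set c; d] |: F) s x = dist ([set c; d] |: F) s y) ->
  forall s, s \in S -> dist ([set a; b] |: F) s x = dist ([set a; b] |: F) s y.
Proof.
move=> br_ab br_cd xa ya eqxy s sS.
have ax : connect (adj F) a x by rewrite connect_adj_sym.
have ay : connect (adj F) a y by rewrite connect_adj_sym.
have [_ /(_ s) /orP[sa | sb]] := br_ab.
  have sx := connect_trans sa ax; have sy := connect_trans sa ay.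
  have := eqxy s; rewrite !inE sS !orbT !bridge_dist_same //; exact.
rewrite [[set a; b]]setUC.
rewrite !(bridge_dist_across (bridge_sym br_ab) sb) //; congr (_ + _).
by have := eqxy a; rewrite setU11 !bridge_dist_same //; exact.
Qed.

(** If [a] does not resolve vertices [x] and [y] of different sides, then the
    triangle inequality puts [y] closer to [d] than [x] is to [c]; if [b] does
    not resolve them either, then also the other way round. *)
Lemma across_resolved a b c d x y :
    bridge a b -> bridge c d -> connect (adj F) a c -> connect (adj F) b d ->
    connect (adj F) x a -> connect (adj F) y b ->
    dist ([set c; d] |: F) a x = dist ([set c; d] |: F) a y ->
  dist ([set c; d] |: F) b x <> dist ([set c; d] |: F) b y.
Proof.
move=> br_ab br_cd ac bd xa yb.
have ax : connect (adj F) a x by rewrite connect_adj_sym.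
have by_ : connect (adj F) b y by rewrite connect_adj_sym.
have xc := connect_trans xa ac; have yd := connect_trans yb bd.
have cx : connect (adj F) c x by rewrite connect_adj_sym.
have dy : connect (adj F) d y by rewrite connect_adj_sym.
rewrite (bridge_dist_same br_cd ax) (bridge_dist_same br_cd by_).
rewrite (bridge_dist_across br_cd ac yd).
rewrite [[set c; d]]setUC (bridge_dist_across (bridge_sym br_cd) bd xc).
by have := dist_triangle ac cx; have := dist_triangle bd dy; lia.
Qed.

(** The two ends of the removed bridge repair any metric generator. *)
Lemma bridge_exchange_generator a b c d S :
    bridge a b -> bridge c d ->
    metric_generator ([set a; b] |: F) S ->
  metric_generator ([set c; d] |: F) (a |: (b |: S)).
Proof.
move=> br_ab; wlog ac : c d / connect (adj F) a c => [IH br_cd | br_cd].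
  have [_ /(_ a) /orP[ac | ad]] := br_cd; first exact: IH.
  by rewrite [[set c; d]]setUC; apply: IH => //; apply: bridge_sym.
have [cd _] := br_cd; have [_ sides] := br_ab.
have bd : connect (adj F) b d.
  have /orP[da | db] := sides d; last by rewrite connect_adj_sym.
  by rewrite connect_adj_sym (connect_trans da ac) in cd.
move=> /metric_generatorP genS; apply/metric_generatorP => x y eqxy.
have [aS bS] : a \in a |: (b |: S) /\ b \in a |: (b |: S).
  by rewrite !inE !eqxx orbT.
have /orP[xa | xb] := sides x; have /orP[ya | yb] := sides y.
- exact/genS/(same_side_unresolved br_ab br_cd xa ya).
- by case: (across_resolved br_ab br_cd ac bd xa yb); apply: eqxy.
- by case: (across_resolved br_ab br_cd ac bd ya xb); apply/esym/eqxy.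
apply: genS; rewrite [[set a; b]]setUC.
apply: (same_side_unresolved (bridge_sym br_ab) br_cd xb yb) => s.
by rewrite setUCA => /eqxy.
Qed.

End Bridge.

(** * Edge exchanges between trees *)

Section Exchange.

Variable V : finType.
Implicit Types (T : {set {set V}}) (S : {set V}).

Lemma tree_connected T x y : is_tree T -> connect (adj T) x y.
Proof. by case=> _ [_ conn_T] _. Qed.

Lemma connect_add_edge_sides (F : {set {set V}}) a b x :
  connect (adj ([set a; b] |: F)) a x ->
  connect (adj F) x a || connect (adj F) x b.
Proof.
case/connectP => p; elim/last_ind: p x => [|p z IHp] x /=.
  by move=> _ ->; rewrite connect0.
rewrite rcons_path last_rcons => /andP[ap pz] ->.
have := IHp _ ap (erefl _).
case/adj_add_edge: pz => [[_ ->] | [_ ->] | ]; rewrite ?connect0 ?orbT //.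
rewrite adj_sym => /connect1 zp /orP[] /(connect_trans zp) ->; rewrite ?orbT //.
Qed.

(** A path of F from [a] to [b] would close up with the edge ab to a cycle. *)
Lemma tree_bridge (F : {set {set V}}) a b :
    is_tree ([set a; b] |: F) -> [set a; b] \notin F -> a != b ->
  bridge F a b.
Proof.
move=> tree_T abF ab; split=> [|x]; last first.
  exact/connect_add_edge_sides/tree_connected.
have [_ _ acyc] := tree_T; apply/negP => /connectP[p /shortenP[q aq uq _] bE].
have /acyc : ucycle (adj ([set a; b] |: F)) (a :: q).
  rewrite /ucycle /= rcons_path (sub_path (@sub_adj_add_edge _ _ _) aq) -bE.
  by rewrite /adj /= [[set b; a]]setUC setU11.
case: q aq bE {uq} => [_ ab_ | z [|? ?]] //=; first by rewrite ab_ eqxx in ab.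
by rewrite /adj /= andbT => azF bz; rewrite bz azF in abF.
Qed.

Lemma edge_exchange_sym T T' :
  simple_graph T -> edge_exchange T T' -> edge_exchange T' T.
Proof.
move=> simple_T [e [f [e2 eT fT ->]]]; exists f, e.
have ef : e != f by apply: contraNneq eT => ->.
split; [exact: simple_T | by rewrite !inE eqxx | by rewrite !inE eqxx ef |].
apply/setP => g; rewrite !inE.
by have [-> | ] := eqVneq g e; [apply/negbTE | have [-> | ] := eqVneq g f].
Qed.

Lemma exchange_generator T T' :
    is_tree T -> is_tree T' -> edge_exchange T T' ->
  exists a b, forall S,
    metric_generator T S -> metric_generator T' (a |: (b |: S)).
Proof.
move=> tree_T tree_T' [e [f [e2 eT fT T'E]]].
have [simple_T _ _] := tree_T.
have /eqP/cards2P[a [b [ab fE]]] := simple_T f fT.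
have /eqP/cards2P[c [d [cd eE]]] := e2.
have ef : e != f by apply: contraNneq eT => ->.
pose F := T :\ f.
have TE : T = [set a; b] |: F by rewrite -fE setD1K.
have {}T'E : T' = [set c; d] |: F.
  rewrite T'E -eE; apply/setP => g; rewrite !inE.
  by have [-> | ] := eqVneq g e; rewrite // ef.
exists a, b => S; rewrite T'E TE; apply: bridge_exchange_generator.
  by apply: tree_bridge; rewrite -?TE // -fE !inE eqxx.
by apply: tree_bridge; rewrite -?T'E // -eE !inE (negbTE eT) andbF.
Qed.

Lemma exchange_dim_le T T' :
    is_tree T -> is_tree T' -> edge_exchange T T' ->
  metric_dim T' <= metric_dim T + 2.
Proof.
move=> tree_T tree_T' TT'.
have conn_T x y := tree_connected x y tree_T.
have conn_T' x y := tree_connected x y tree_T'.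
have [S /(metric_basisP conn_T)[genS <-]] := metric_basis_exists conn_T.
have [a [b /(_ S genS) gen_abS]] := exchange_generator tree_T tree_T' TT'.
apply: leq_trans (metric_dim_le conn_T' gen_abS) _.
by rewrite !cardsU1; case: (a \notin _); case: (b \notin _); lia.
Qed.

(** When the dimension grows by two, the generator obtained by adding the ends
    of the removed edge is a basis. *)
Lemma exchange_basis_extends T T' S :
    is_tree T -> is_tree T' -> edge_exchange T T' ->
    metric_dim T' = metric_dim T + 2 -> metric_basis T S ->
  exists2 S', metric_basis T' S' & S \subset S'.
Proof.
move=> tree_T tree_T' TT' dimT'.
have conn_T x y := tree_connected x y tree_T.
have conn_T' x y := tree_connected x y tree_T'.
move=> /(metric_basisP conn_T)[genS cardS].
have [a [b /(_ S genS) gen_abS]] := exchange_generator tree_T tree_T' TT'.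
exists (a |: (b |: S)); last by apply/subsetP => x xS; rewrite !inE xS !orbT.
apply/(metric_basisP conn_T'); split; first exact: gen_abS.
apply/eqP; rewrite eqn_leq metric_dim_le // andbT dimT' -cardS.
by rewrite !cardsU1; case: (a \notin _); case: (b \notin _); lia.
Qed.

End Exchange.

(** * Sequences of exchanges *)

Section Sequence.

Variable V : finType.
Implicit Types T : nat -> {set {set V}}.

Lemma exchange_sequence_pred k T :
  exchange_sequence k.+1 T -> exchange_sequence k T.
Proof.
by case=> trees steps; split=> i ik; [apply: trees | apply: steps]; lia.
Qed.

Lemma exchange_sequence_dim_le k T : exchange_sequence k.+1 T ->
  metric_dim (T k.+1) <= metric_dim (T 1) + 2 * k.
Proof.
elim: k => [|k IHk] seq_T; first by rewrite addn0.
have [trees steps] := seq_T.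
have step : metric_dim (T k.+2) <= metric_dim (T k.+1) + 2.
  by apply: exchange_dim_le; [apply: trees | apply: trees | apply: steps]; lia.
have := IHk (exchange_sequence_pred seq_T); lia.
Qed.

(** If the total growth is maximal, every exchange adds two to the dimension, so
    a basis of the first tree grows along the sequence. *)
Lemma exchange_sequence_basis k T : exchange_sequence k.+1 T ->
    metric_dim (T k.+1) = metric_dim (T 1) + 2 * k ->
  basis_containing_all k.+1 T k.+1.
Proof.
elim: k => [|k IHk] seq_T dimT; have [trees steps] := seq_T.
  have conn_T1 x y := tree_connected x y (trees 1 isT).
  have [S basisS] := metric_basis_exists conn_T1.
  exists S => // i; rewrite -eqn_leq => /eqP <-; exists S => //.
have seq_T' := exchange_sequence_pred seq_T.
have tree1 : is_tree (T k.+1) by apply: trees; lia.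
have tree2 : is_tree (T k.+2) by apply: trees; lia.
have step : edge_exchange (T k.+1) (T k.+2) by apply: steps; lia.
have le1 := exchange_sequence_dim_le seq_T'.
have le2 := exchange_dim_le tree1 tree2 step.
have [|S basisS subS] := IHk seq_T'; first by lia.
have [|S' basisS' SS'] := exchange_basis_extends tree1 tree2 step _ basisS.
  by lia.
exists S' => // i /andP[i1]; rewrite leq_eqVlt => /orP[/eqP-> | ik].
  by exists S'.
have [|Si basisSi SiS] := subS i; first by rewrite i1.
by exists Si => //; apply: subset_trans SS'.
Qed.

Lemma exchange_sequence_rev k T :
  exchange_sequence k T -> exchange_sequence k (fun i => T (k.+1 - i)).
Proof.
case=> trees steps; split=> i ik; first by apply: trees; lia.
apply: edge_exchange_sym.
  by have [|] := trees (k.+1 - i.+1); first lia.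
have -> : k.+1 - i = (k.+1 - i.+1).+1 by lia.
by apply: steps; lia.
Qed.

Lemma basis_containing_all_rev k T j : 0 < j <= k ->
    basis_containing_all k (fun i => T (k.+1 - i)) (k.+1 - j) ->
  basis_containing_all k T j.
Proof.
move=> jk; have kK i : 0 < i <= k -> k.+1 - (k.+1 - i) = i by lia.
case=> S; rewrite (kK j jk) => basisS subS; exists S; first exact: basisS.
move=> i ik; have [|S'] := subS (k.+1 - i); first by lia.
by rewrite (kK i ik); exists S'.
Qed.

Lemma exchange_sequence_bounds k T :
  exchange_sequence k.+1 T -> exchange_bounds k.+1 T (2 * k).
Proof.
move=> seq_T; have seq_T' := exchange_sequence_rev seq_T.
have dim_le := exchange_sequence_dim_le seq_T'.
have basis := exchange_sequence_basis seq_T'.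
have e1 : k.+2 - k.+1 = 1 by lia.
have ek : k.+2 - 1 = k.+1 by lia.
rewrite e1 ek in dim_le basis; split.
- exact: dim_le.
- exact: exchange_sequence_dim_le.
- exact: exchange_sequence_basis.
by move=> /basis basis1; apply: basis_containing_all_rev; rewrite ?ek.
Qed.

Lemma exchange_bounds_lt k T c c' :
  c < c' -> exchange_bounds k T c -> exchange_bounds k T c'.
Proof. by move=> cc' [le1 le2 _ _]; split; lia. Qed.

End Sequence.

(** * Trees given by a parent function *)

Section ParentGraph.

Variable V : finType.
Implicit Types (par : V -> V) (g h : V -> nat) (u v w x y : V).

(** The root is the fixed point of [par]. *)
Definition parent_graph par : {set {set V}} :=
  [set [set x; par x] | x in [pred x | par x != x]].

Lemma adj_parent_graph par u v :
  adj (parent_graph par) u v = (u != v) && ((v == par u) || (u == par v)).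
Proof.
apply/idP/andP => [/imsetP[x xpar /eq_set2P] | [uv]].
  by rewrite inE in xpar => -[[-> ->] | [-> ->]];
    rewrite ?eqxx ?orbT // eq_sym.
case/orP=> /eqP vE; apply/imsetP; [exists u | exists v]; rewrite ?inE -vE //.
  by rewrite eq_sym.
by rewrite setUC.
Qed.

Section Tree.

Variables (par : V -> V) (h : V -> nat) (r : V).
Hypothesis h_par : forall x, par x != x -> h (par x) < h x.
Hypothesis root : forall x, par x = x -> x = r.

Lemma parent_graph_connected x y : connect (adj (parent_graph par)) x y.
Proof.
suffices to_r z : connect (adj (parent_graph par)) z r.
  by apply: connect_trans (to_r x) _; rewrite connect_adj_sym.
have [n] := ubnP (h z); elim: n z => // n IHn z hz.
have [/root -> // | zpar] := eqVneq (par z) z.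
apply: connect_trans (connect1 _) (IHn (par z) _).
  by rewrite adj_parent_graph eq_sym zpar eqxx.
by rewrite (leq_trans (h_par zpar)).
Qed.

(** The two neighbours on a cycle of a vertex of maximal depth would both be its
    parent. *)
Lemma parent_graph_acyclic : acyclic_graph (parent_graph par).
Proof.
move=> c /andP[cyc_c uniq_c]; rewrite leqNgt; apply/negP => c3.
have [x0 x0c] : exists x0, x0 \in c.
  by case: c c3 {cyc_c uniq_c} => // x0 c _; exists x0; rewrite mem_head.
have [x xc x_max] := arg_maxnP h x0c.
have up y : y \in c -> adj (parent_graph par) x y -> y = par x.
  move=> /x_max hyx; rewrite adj_parent_graph => /andP[xy /orP[/eqP // | xE]].
  move: hyx xy; rewrite (eqP xE) => hyx /h_par; lia.
have [i c' cE] := rot_to xc.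
have mem_c y : y \in x :: c' -> y \in c by rewrite -cE mem_rot.
move: c3 cyc_c uniq_c; rewrite -(size_rot i) -(rot_cycle i) -(rot_uniq i) cE.
case: c' mem_c {cE} => [|y [|z c']] mem_c //= _ /andP[xy /andP[_]].
rewrite rcons_path => /andP[_ zx] /and3P[_ yz _].
have zE : last z c' = par x.
  apply: up; last by rewrite adj_sym.
  by apply: mem_c; rewrite in_cons [_ \in y :: _]in_cons mem_last !orbT.
have yE : y = par x by apply: up xy; rewrite mem_c // !in_cons eqxx orbT.
by rewrite yE -zE mem_last in yz.
Qed.

Lemma parent_graph_tree : is_tree (parent_graph par).
Proof.
split; last exact: parent_graph_acyclic.
  move=> _ /imsetP[x xpar ->]; rewrite inE in xpar.
  by rewrite cards2 eq_sym xpar.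
by split; [apply/card_gt0P; exists r | apply: parent_graph_connected].
Qed.

(** Vertices that are not parents are pendant. *)
Lemma parent_graph_generator_card S :
  metric_generator (parent_graph par) S ->
  #|V| <= #|S| + 2 * #|par @: [set: V]|.
Proof.
apply: (@pendant_lower_bound _ _ parent_graph_connected _ par) => x.
  by move=> _; apply: imset_f.
move=> /imsetP xH u; rewrite adj_parent_graph; have [-> | ux] := eqVneq u x.
  by apply/esym/eqP => xpar; apply: xH; exists x.
by have [xE | //] := eqVneq x (par u); case: xH; exists u.
Qed.

Lemma parent_graph_dist g s x :
    g s = 0 -> (forall v, g v <= (g (par v)).+1 /\ g (par v) <= (g v).+1) ->
    (forall v, v != s -> exists2 u,
       adj (parent_graph par) u v & g v = (g u).+1) ->
  dist (parent_graph par) s x = g x.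
Proof.
move=> gs g_lip g_desc; apply: dist_unique => //; last first.
  exact: parent_graph_connected.
move=> u v; rewrite adj_parent_graph => /andP[_ /orP[] /eqP ->].
  by have [] := g_lip u.
by have [] := g_lip v.
Qed.

End Tree.

(** Removing the edge from [u] to its parent and attaching the detached subtree
    by its vertex [w] elsewhere reverses the edge between [u] and [w]. *)
Lemma parent_graph_exchange par par' u w :
    par w = u -> par' u = w ->
    (forall x, x != u -> x != w -> par' x = par x) ->
    par u != u -> par' w != w ->
    par u != w -> par' w != u -> par' (par u) != u -> par (par' w) != w ->
  edge_exchange (parent_graph par) (parent_graph par').
Proof.
move=> wu uw eqpar nu nw uNw wNu nparu nparw.
have uDw : u != w by apply: contraNneq nu => uE; rewrite {1}uE wu.
have fE : [set u; par u] \in parent_graph par by apply/imsetP; exists u.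
have eE' : [set w; par' w] \in parent_graph par' by apply/imsetP; exists w.
have eE : [set w; par' w] \notin parent_graph par.
  rewrite -[_ \in _]/(adj (parent_graph par) w (par' w)) adj_parent_graph wu.
  by rewrite negb_and (negbTE wNu) eq_sym (negbTE nw) /= eq_sym.
have fE' : [set u; par u] \notin parent_graph par'.
  rewrite -[_ \in _]/(adj (parent_graph par') u (par u)) adj_parent_graph uw.
  by rewrite negb_and (negbTE uNw) eq_sym (negbTE nu) /= eq_sym.
exists [set w; par' w], [set u; par u]; split=> //.
  by rewrite cards2 eq_sym nw.
apply/eqP; rewrite eqEsubset; apply/andP; split; apply/subsetP => g gE.
  rewrite in_setD1 in_setU1; apply/andP; split.
    by apply: contraTneq gE => ->.
  case/imsetP: gE => x xpar ->; have [-> | xw] := eqVneq x w.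
    by rewrite eqxx.
  apply/orP; right; rewrite -[_ \in _]/(adj _ _ _) adj_parent_graph.
  have [-> | xu] := eqVneq x u; first by rewrite uw wu uDw eqxx orbT.
  by rewrite inE eqpar // in xpar *; rewrite eq_sym xpar eqxx.
move: gE; rewrite in_setD1 in_setU1 => /andP[gf /orP[/eqP -> // | gE]].
case/imsetP: gE gf => x xpar ->; have [-> | xu] := eqVneq x u.
  by rewrite eqxx.
move=> _; rewrite -[_ \in _]/(adj _ _ _) adj_parent_graph.
have [-> | xw] := eqVneq x w; first by rewrite wu uw eq_sym uDw eqxx orbT.
by rewrite inE -eqpar // in xpar *; rewrite eq_sym xpar eqxx.
Qed.

End ParentGraph.

(** * Trees gaining two at every exchange *)

Section Gadgets.

Variable m : nat.

(** The hub [inl None] has two leaves [inl (Some _)]. Gadget [i] is made of the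
    path vertices [inr (i, inl false)] and [inr (i, inl true)], a centre
    [inr (i, inr None)] and its two leaves [inr (i, inr (Some _))]. *)
Local Notation V := (option bool + 'I_m * (bool + option bool))%type.

(** In every gadget the path joins the hub to the centre; in the first [j]
    gadgets the edge inside the path is replaced by one from the hub to the
    centre, which leaves two pendant path vertices. *)
Definition gadget_parent (j : nat) (v : V) : V :=
  match v with
  | inl _ | inr (_, inl false) => inl None
  | inr (i, inl true) => inr (i, if i < j then inr None else inl false)
  | inr (i, inr None) => if i < j then inl None else inr (i, inl true)
  | inr (i, inr (Some _)) => inr (i, inr None)
  end.

Definition gadget_depth (j : nat) (v : V) : nat :=
  match v with
  | inl None => 0
  | inl (Some _) | inr (_, inl false) => 1
  | inr (_, inl true) => 2
  | inr (i, inr None) => if i < j then 1 else 3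
  | inr (_, inr (Some _)) => 4
  end.

Definition gadget_tree (j : nat) : {set {set V}} :=
  parent_graph (gadget_parent j).

Lemma gadget_depth_parent j v :
  gadget_parent j v != v ->
  gadget_depth j (gadget_parent j v) < gadget_depth j v.
Proof.
case: v => [[b|]|[i [[]|[b|]]]] //=; rewrite ?eqxx //;
  by case: ifP => //= ij _; rewrite ?ij.
Qed.

Lemma gadget_root j v : gadget_parent j v = v -> v = inl None.
Proof. by case: v => [[b|]|[i [[]|[b|]]]] //=; case: ifP. Qed.

Lemma gadget_treeP j : is_tree (gadget_tree j).
Proof. exact: parent_graph_tree (@gadget_depth_parent j) (@gadget_root j). Qed.

Lemma gadget_exchange j :
  j < m -> edge_exchange (gadget_tree j) (gadget_tree j.+1).
Proof.
move=> jm; pose i := Ordinal jm.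
have ltj : (i < j) = false by rewrite ltnn.
have ltjS : i < j.+1 by rewrite /=.
apply: (@parent_graph_exchange _ _ _ (inr (i, inl true)) (inr (i, inr None)));
  rewrite /gadget_parent ?ltj ?ltjS //.
have other (i' : 'I_m) : i' != i -> (i' < j.+1) = (i' < j).
  by move=> i'i; rewrite ltnS leq_eqVlt [_ == j :> nat](negbTE i'i).
case=> [[b|]|[i' [[]|[b|]]]] //; have [-> | /other ->] := eqVneq i' i => //.
- by rewrite eqxx.
- by rewrite eqxx.
- by apply/eqP.
by apply/eqP.
Qed.

(** In the last tree the hub and the centres are the only vertices that are not
    pendant. *)
Lemma gadget_dim_ge : 3 * m + 1 <= metric_dim (gadget_tree m).
Proof.
have conn x y := tree_connected x y (gadget_treeP m).
have [S /(metric_basisP conn)[genS <-]] := metric_basis_exists conn.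
have le_V := parent_graph_generator_card (@gadget_depth_parent m)
  (@gadget_root m) genS.
pose inner (o : option 'I_m) : V :=
  if o is Some i then inr (i, inr None) else inl None.
have sub_inner : gadget_parent m @: [set: V] \subset inner @: setT.
  apply/subsetP => _ /imsetP[v _ ->]; apply/imsetP.
  case: v => [b|[i [[]|[b|]]]] /=; rewrite ?ltn_ord;
    by [exists None | exists (Some i)].
have le_inner : #|gadget_parent m @: [set: V]| <= m.+1.
  rewrite (leq_trans (subset_leq_card sub_inner)) //.
  by rewrite (leq_trans (leq_imset_card _ _)) // cardsT card_option card_ord.
rewrite -(leq_add2r (2 * m.+1)).
apply: leq_trans (leq_trans le_V (leq_add (leqnn _) (leq_mul _ le_inner))) => //.
by rewrite !card_sum card_prod card_sum !card_option card_bool card_ord; lia.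
Qed.

Definition hub_leaf_dist (v : V) : nat :=
  if v == inl (Some true) then 0 else (gadget_depth 0 v).+1.

(** Outside gadget [i], the distance to its leaf is four plus the distance to
    the hub. *)
Definition gadget_leaf_dist (i : 'I_m) (v : V) : nat :=
  let far := 4 + gadget_depth 0 v in
  match v with
  | inl _ => far
  | inr (i', t) => if i' != i then far else
    match t with
    | inl false => 3
    | inl true => 2
    | inr None => 1
    | inr (Some b) => if b then 0 else 2
    end
  end.

Lemma hub_leaf_distE v :
  dist (gadget_tree 0) (inl (Some true)) v = hub_leaf_dist v.
Proof.
apply: (parent_graph_dist (@gadget_depth_parent 0) (@gadget_root 0)) => //.
  by case=> [[[]|]|[i [[]|[b|]]]].
move=> v0 v0s; exists (if v0 == inl None then inl (Some true)
                       else gadget_parent 0 v0).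
  rewrite adj_parent_graph.
  by move: v0 v0s => [[[]|]|[i [[]|[b|]]]] //= _;
    rewrite ?eqxx ?orbT ?andbT //; apply/eqP.
by move: v0 v0s => [[[]|]|[i [[]|[b|]]]].
Qed.

Lemma gadget_leaf_distE i v :
  dist (gadget_tree 0) (inr (i, inr (Some true))) v = gadget_leaf_dist i v.
Proof.
apply: (parent_graph_dist (@gadget_depth_parent 0) (@gadget_root 0)).
- by rewrite /= eqxx.
- by case=> [[[]|]|[i' [[]|[[]|]]]] //=; case: eqVneq.
move=> v0 v0s.
(* A neighbour one step closer: the child towards gadget [i] for the hub and
   the vertices above the leaf, and the parent otherwise. *)
exists (match v0 with
        | inl None => inr (i, inl false)
        | inr (i', inl b) => if i' != i then gadget_parent 0 v0
                             else inr (i, if b then inr None else inl true)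
        | inr (i', inr None) => if i' != i then gadget_parent 0 v0
                                else inr (i, inr (Some true))
        | _ => gadget_parent 0 v0
        end).
  rewrite adj_parent_graph.
  case: v0 {v0s} => [[b|]|[i' t]] //=; rewrite ?eqxx //.
  have [-> | _] := eqVneq i' i; case: t => [[]|[b|]] /=;
    by rewrite ?eqxx ?orbT ?andbT //; apply/eqP.
case: v0 v0s => [[b|]|[i' t]] //=; rewrite ?eqxx //.
have [-> | /negbTE i'i] := eqVneq i' i; case: t => [[]|[[]|]];
  by rewrite /= ?eqxx ?i'i.
Qed.

Lemma gadget_dim_le : metric_dim (gadget_tree 0) <= m.+1.
Proof.
have conn x y := tree_connected x y (gadget_treeP 0).
pose leaf (o : option 'I_m) : V :=
  if o is Some i then inr (i, inr (Some true)) else inl (Some true).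
apply: leq_trans (metric_dim_le conn (_ : metric_generator _ (leaf @: setT))) _.
  apply/metric_generatorP => x y eqxy.
  have eq_hub : hub_leaf_dist x = hub_leaf_dist y.
    by rewrite -!hub_leaf_distE; apply/eqxy/imsetP; exists None.
  have eq_gadget i : gadget_leaf_dist i x = gadget_leaf_dist i y.
    by rewrite -!gadget_leaf_distE; apply/eqxy/imsetP; exists (Some i).
  move: x y {eqxy} eq_hub eq_gadget; rewrite /hub_leaf_dist.
  case=> [[[]|]|[i t]] [[[]|]|[i' t']] //= eq_hub eq_gadget.
  - by have := eq_gadget i'; rewrite eqxx; case: t' {eq_hub eq_gadget} => [[]|[[]|]].
  - by have := eq_gadget i'; rewrite eqxx; case: t' {eq_hub eq_gadget} => [[]|[[]|]].
  - by have := eq_gadget i; rewrite eqxx; case: t {eq_hub eq_gadget} => [[]|[[]|]].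
  - by have := eq_gadget i; rewrite eqxx; case: t {eq_hub eq_gadget} => [[]|[[]|]].
  have := eq_gadget i; rewrite eqxx /= {eq_gadget}.
  by have [-> | _] := eqVneq i' i; case: t t' eq_hub => [[]|[[]|]] [[]|[[]|]].
by rewrite (leq_trans (leq_imset_card _ _)) // cardsT card_option card_ord.
Qed.

End Gadgets.

Lemma gadget_sequence m :
  exchange_sequence m.+1 (fun i => @gadget_tree m i.-1).
Proof.
split=> [i _ | [//|i] im]; first exact: gadget_treeP.
exact: gadget_exchange.
Qed.

Lemma gadget_sequence_dim m :
  metric_dim (@gadget_tree m m) = metric_dim (@gadget_tree m 0) + 2 * m.
Proof.
have le_dim := exchange_sequence_dim_le (@gadget_sequence m).
apply/eqP; rewrite eqn_leq le_dim /=.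
by have := gadget_dim_le m; have := gadget_dim_ge m; lia.
Qed.

Theorem corollary5p4 :
  (forall (V : finType) (k : nat) (T : nat -> {set {set V}}),
     0 < k -> exchange_sequence k T ->
     exchange_bounds k T (2 * k) /\ exchange_bounds k T (2 * (k - 1)))
  /\
  (forall k : nat, 0 < k ->
     (exists (V : finType) (T : nat -> {set {set V}}),
        exchange_sequence k T /\
        metric_dim (T k) = metric_dim (T 1) + 2 * (k - 1))
     /\
     (exists (V : finType) (T : nat -> {set {set V}}),
        exchange_sequence k T /\
        metric_dim (T 1) = metric_dim (T k) + 2 * (k - 1))).
Proof.
split=> [V [//|k] T _ seq_T | [//|m] _]; rewrite subn1.
  have bounds := exchange_sequence_bounds seq_T.
  by split=> //; apply: exchange_bounds_lt bounds; lia.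
split; first by do 2!eexists; split;
  [exact: gadget_sequence | exact: gadget_sequence_dim].
do 2!eexists; split; first exact: exchange_sequence_rev (@gadget_sequence m).
by rewrite /= subSS subSnn; apply: gadget_sequence_dim.
Qed.
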